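(* Let $X$ be a set and let $\mathbf{d},\mathbf{e}:X\times X\to[0,\infty]$ be distances. Suppose that at least one of the following four conditions holds. (1) $\underline{\mathbf{d}}\circ\mathord{\leq^{\mathbf{d}\mathcal{P}}}\precapprox\mathbf{d}\mathcal{P}$, and every $<^{\mathbf{d}}$-directed subset of $X$ has a $\mathbf{d}$-maximum. (2) $\mathord{\leq^{\mathcal{F}\mathbf{d}}}\circ\overline{\mathbf{d}}\leq\mathcal{F}\mathbf{d}$ (pointwise), every $\leq^{\mathbf{d}}$-directed subset of $X$ has a $\mathbf{d}$-maximum, and $X$ is $(\underline{\mathbf{d}}^\vee)_\circ$-complete, i.e. every $\underline{\mathbf{d}}^\vee$-Cauchy net in $X$ converges to some point of $X$ in the topology $(\underline{\mathbf{d}}^\vee)_\circ$. (3) $\mathbf{e}\circ\Phi^{\overline{\mathbf{d}}}\precapprox\mathbf{d}$, $\underline{\mathbf{d}}\precapprox\mathbf{e}$, $\overline{\mathbf{d}}^{\mathrm{op}}\precapprox\mathbf{e}$, every $\mathbf{d}$-directed subset of $X$ has a $\mathbf{d}$-maximum, and every $\mathbf{e}$-Cauchy net in $X$ converges to some point of $X$ in the topology $\mathbf{e}_\circ$. (4) $\mathbf{e}\circ\Phi^{\mathbf{d}}\precapprox\mathbf{d}$, $\underline{\mathbf{d}}\precapprox\mathbf{e}$, $\overline{\mathbf{d}}^{\mathrm{op}}\precapprox\mathbf{e}$, every $\leq^{\mathbf{d}}$-directed subset of $X$ has a $\mathbf{d}$-maximum, every $\mathbf{e}$-Cauchy net in $X$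 converges to some point of $X$ in the topology $\mathbf{e}_\circ$, and $X$ has a countable subset that is dense in the topology $\overline{\mathbf{d}}^\bullet_\bullet$. Then $X$ is $\mathbf{d}^\bullet_\circ$-complete: every $\mathbf{d}$-Cauchy net in $X$ converges to some point of $X$ in the topology $\mathbf{d}^\bullet_\circ$.
   Context: Write $x\mathbf{d}y=\mathbf{d}(x,y)$. Conventions: $a_+=\max(a,0)$, $\infty-\infty=0$, $\inf\emptyset=\infty$, $\sup\emptyset=0$ in $[0,\infty]$. A relation $\sqsubset\,\subseteq A\times B$ is identified with the function $A\times B\to[0,\infty]$ equal to $0$ where the relation holds and $\infty$ elsewhere. For $\mathbf{f}:A\times C\to[0,\infty]$, $\mathbf{g}:C\times B\to[0,\infty]$, $a(\mathbf{f}\circ\mathbf{g})b=\inf_{c\in C}(a\mathbf{f}c+c\mathbf{g}b)$. $\mathbf{d}$ is a distance if $x\mathbf{d}y\leq x\mathbf{d}z+z\mathbf{d}y$ for all $x,y,z$. $x\mathbf{d}^{\mathrm{op}}y=y\mathbf{d}x$ and $\mathbf{d}^\vee=\max(\mathbf{d},\mathbf{d}^{\mathrm{op}})$ pointwise. $x\overline{\mathbf{d}}z=\sup_{y\in X}(x\mathbf{d}y-z\mathbf{d}y)_+$ and $z\underline{\mathbf{d}}y=\sup_{x\in X}(x\mathbf{d}y-x\mathbf{d}z)_+$. For any $\mathbf{f}:A\times B\to[0,\infty]$: $a\leq^{\mathbf{f}}b$ iff $a\mathbf{f}b=0$, and $a<^{\mathbf{f}}_\epsilon b$ iff $a\mathbf{f}b<\epsilon$.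 $x<^{\mathbf{d}}y$ means: there is $\epsilon>0$ such that for all $z\in X$, $y\underline{\mathbf{d}}z<\epsilon$ implies $x\mathbf{d}z=0$. $\mathbf{d}\mathcal{P}:X\times\mathcal{P}(X)\to[0,\infty]$ is $x(\mathbf{d}\mathcal{P})Z=\sup_{z\in Z}x\mathbf{d}z$. With $\mathcal{F}(X)$ the set of finite subsets of $X$, $\mathcal{F}\mathbf{d}:\mathcal{F}(X)\times X\to[0,\infty]$ is $F(\mathcal{F}\mathbf{d})y=\sup_{x\in F}x\mathbf{d}y$. For $\mathbf{e},\mathbf{f}:X\times X\to[0,\infty]$, $\mathbf{e}\circ\Phi^{\mathbf{f}}=\sup_{n\in\mathbb{N}}(\mathbf{e}\circ n\mathbf{f})=\sup_{\epsilon>0}(\mathbf{e}\circ\mathord{<^{\mathbf{f}}_\epsilon})$. Uniform preorder: for $\mathbf{f},\mathbf{g}:A\times B\to[0,\infty]$, $\mathbf{f}\precapprox\mathbf{g}$ iff for every $Z\subseteq A\times B$, $\inf_{(a,b)\in Z}a\mathbf{g}b=0$ implies $\inf_{(a,b)\in Z}a\mathbf{f}b=0$ (equivalently, for all $\epsilon>0$ there is $\delta>0$ such that $a\mathbf{g}b<\delta$ implies $a\mathbf{f}b<\epsilon$ for all $a,b$). Nets $(x_\lambda)_{\lambda\in\Lambda}$ are indexed by non-empty sets $\Lambda$ with a transitive, possibly non-reflexive relation $\prec$ such that for all $\gamma,\delta$ there is $\lambda$ with $\gamma,\delta\prec\lambda$; $x_\lambda\to x$ in a topology iff for every open $O\ni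 x$ there is $\gamma$ with $x_\lambda\in O$ for all $\lambda\succ\gamma$. $(x_\lambda)$ is $\mathbf{d}$-Cauchy iff $\lim_\gamma\sup_{\delta\succ\gamma}x_\gamma\mathbf{d}x_\delta=0$. Topologies on $X$, for $\mathbf{f}:X\times X\to[0,\infty]$: $\mathbf{f}^\bullet$ has subbasis the sets $\{y:c\mathbf{f}y<r\}$; $\mathbf{f}_\bullet$ has subbasis $\{x:x\mathbf{f}c<r\}$; $\mathbf{f}_\circ$ has subbasis $\{x:c\mathbf{f}x>r\}$ ($c\in X$, $r\in(0,\infty)$). $\mathbf{f}^\bullet_\bullet$ is generated by $\mathbf{f}^\bullet\cup\mathbf{f}_\bullet$ and $\mathbf{f}^\bullet_\circ$ by $\mathbf{f}^\bullet\cup\mathbf{f}_\circ$. $Y\subseteq X$ is $\mathbf{d}$-directed if for every finite $F\subseteq Y$, $\inf_{y\in Y}\sup_{x\in F}x\mathbf{d}y=0$; for a relation $\sqsubset$ (such as $\leq^{\mathbf{d}}$ or $<^{\mathbf{d}}$), $\sqsubset$-directed means every finite $F\subseteq Y$ (including $\emptyset$) has some $y\in Y$ with $x\sqsubset y$ for all $x\in F$. $x$ is a $\mathbf{d}$-maximum of $Y$ if $y\mathbf{d}x=0$ for all $y\in Y$ and $\inf_{y\in Y}z\mathbf{d}y\leq z\mathbf{d}x$ for all $z\in X$. *)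

(* Defs.v *)
(* The values [0, oo] are modelled by \bar R for R : realType:
   distances carry a nonnegativity clause (see [is_distance]), and every
   derived function below takes nonnegative values on nonnegative functions. *)
From HB Require Import structures.
From mathcomp Require Import all_boot all_order all_algebra.
From mathcomp Require Import all_classical all_reals all_analysis.

Set Implicit Arguments.
Unset Strict Implicit.
Unset Printing Implicit Defensive.

Import Order.TTheory GRing.Theory Num.Theory.
Import numFieldNormedType.Exports.

Local Open Scope classical_set_scope.
Local Open Scope ring_scope.
Local Open Scope ereal_scope.

Section GeneralizedRelations.
Context {R : realType}.

(* Supremum in [0, oo]: the supremum of the empty set is 0, not -oo. The library
   infimum already has ereal_inf set0 = +oo. *)
Definition sup_nneg (S : set (\bar R)) : \bar R := ereal_sup (0 |` S).

(* (a - b)_+ with oo - oo = 0: in \bar R, +oo - +oo = -oo, which is truncated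
   to 0. *)
Definition trunc_sub (a b : \bar R) : \bar R := maxe (a - b) 0.

Definition rel_dist {A B : Type} (r : A -> B -> Prop) : A -> B -> \bar R :=
  fun a b => if `[< r a b >] then 0 else +oo.

Definition dist_comp {A C B : Type} (f : A -> C -> \bar R)
    (g : C -> B -> \bar R) : A -> B -> \bar R :=
  fun a b => ereal_inf [set f a c + g c b | c in [set: C]].

Definition is_distance {X : Type} (d : X -> X -> \bar R) : Prop :=
  (forall x y, 0 <= d x y) /\ (forall x y z, d x y <= d x z + d z y).

Definition dist_op {X : Type} (d : X -> X -> \bar R) : X -> X -> \bar R :=
  fun x y => d y x.

Definition dist_sym {X : Type} (d : X -> X -> \bar R) : X -> X -> \bar R :=
  fun x y => maxe (d x y) (dist_op d x y).

(* \overline d and, next, \underline d. *)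
Definition dist_over {X : Type} (d : X -> X -> \bar R) : X -> X -> \bar R :=
  fun x z => sup_nneg [set trunc_sub (d x y) (d z y) | y in [set: X]].

Definition dist_under {X : Type} (d : X -> X -> \bar R) : X -> X -> \bar R :=
  fun z y => sup_nneg [set trunc_sub (d x y) (d x z) | x in [set: X]].

Definition le_rel {A B : Type} (f : A -> B -> \bar R) : A -> B -> Prop :=
  fun a b => f a b = 0.

(* x <^d y, not the pointwise relation d x y < eps. *)
Definition lt_rel {X : Type} (d : X -> X -> \bar R) : X -> X -> Prop :=
  fun x y => exists eps : R, (0 < eps)%R /\
    forall z, dist_under d y z < eps%:E -> d x z = 0.

Definition dist_set {X : Type} (d : X -> X -> \bar R) : X -> set X -> \bar R :=
  fun x Z => sup_nneg [set d x z | z in Z].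

Definition finsub (X : Type) : Type := {F : set X | finite_set F}.

Definition finset_dist {X : Type} (d : X -> X -> \bar R) :
    finsub X -> X -> \bar R :=
  fun F y => sup_nneg [set d x y | x in sval F].

(* e o Phi^f = sup_n (e o n f). The product in \bar R has 0 * oo = 0; the term
   n = 0 is below the term n = 1, so it does not affect the supremum. *)
Definition comp_Phi {X : Type} (e f : X -> X -> \bar R) : X -> X -> \bar R :=
  fun a b => sup_nneg
    [set dist_comp e (fun x y => n%:R%:E * f x y) a b | n in [set: nat]].

Definition precapprox {A B : Type} (f g : A -> B -> \bar R) : Prop :=
  forall Z : set (A * B),
    ereal_inf [set g p.1 p.2 | p in Z] = 0 ->
    ereal_inf [set f p.1 p.2 | p in Z] = 0.

Definition dist_directed {X : Type} (d : X -> X -> \bar R) (Y : set X) : Prop :=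
  forall F : set X, finite_set F -> F `<=` Y ->
    ereal_inf [set sup_nneg [set d x y | x in F] | y in Y] = 0.

Definition dist_maximum {X : Type} (d : X -> X -> \bar R) (Y : set X) (x : X) :
    Prop :=
  (forall y, Y y -> d y x = 0) /\
  (forall z, ereal_inf [set d z y | y in Y] <= d z x).

(* The subbases of f^\bullet, f_\bullet and f_\circ, respectively. *)
Definition sub_upper_ball {X : Type} (f : X -> X -> \bar R) : set (set X) :=
  [set O | exists c (r : R), (0 < r)%R /\ O = [set y | f c y < r%:E]].

Definition sub_lower_ball {X : Type} (f : X -> X -> \bar R) : set (set X) :=
  [set O | exists c (r : R), (0 < r)%R /\ O = [set x | f x c < r%:E]].

Definition sub_lower_hole {X : Type} (f : X -> X -> \bar R) : set (set X) :=
  [set O | exists c (r : R), (0 < r)%R /\ O = [set x | r%:E < f c x]].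

End GeneralizedRelations.

Definition rel_directed {X : Type} (r : X -> X -> Prop) (Y : set X) : Prop :=
  forall F : set X, finite_set F -> F `<=` Y ->
    exists2 y, Y y & forall x, F x -> r x y.

(* [subbase_space S] is X with the topology that has S as a subbasis. The
   topology generated by the union of two topologies has the union of their
   subbases as a subbasis. *)
Definition subbase_space (X : Type) (S : set (set X)) : Type := X.

Section GeneratedTopology.
Variables (X : Type) (S : set (set X)).
HB.instance Definition _ := gen_eqMixin (subbase_space S).
HB.instance Definition _ := gen_choiceMixin (subbase_space S).
HB.instance Definition _ :=
  isSubBaseTopological.Build (subbase_space S) S (fun O : set X => O).
End GeneratedTopology.

(* [prec] need not be reflexive. *)
Definition net_index {L : Type} (prec : L -> L -> Prop) : Prop :=
  [/\ inhabited L,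
      forall a b c, prec a b -> prec b c -> prec a c &
      forall a b, exists c, prec a c /\ prec b c].

Definition net_tails {L : Type} (prec : L -> L -> Prop) : set_system L :=
  [set A | exists a, forall l, prec a l -> A l].

Definition net_cvg {X L : Type} (S : set (set X)) (prec : L -> L -> Prop)
    (x : L -> X) (p : X) : Prop :=
  (x : L -> subbase_space S) @ net_tails prec --> (p : subbase_space S).

(* The limit along the net of the tail suprema is 0 in \bar R. *)
Definition net_cauchy {R : realType} {X L : Type} (d : X -> X -> \bar R)
    (prec : L -> L -> Prop) (x : L -> X) : Prop :=
  (fun g => sup_nneg [set d (x g) (x l) | l in prec g]) @ net_tails prec --> 0.

(* Every d-Cauchy net converges in the topology with subbasis S. *)
Definition net_complete {R : realType} {X : Type} (d : X -> X -> \bar R)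
    (S : set (set X)) : Prop :=
  forall (L : Type) (prec : L -> L -> Prop) (x : L -> X),
    net_index prec -> net_cauchy d prec x -> exists p, net_cvg S prec x p.

Definition separable_for {X : Type} (S : set (set X)) : Prop :=
  exists D : set X, countable D /\ dense (D : set (subbase_space S)).

(* Main.v *)
(** For a d-Cauchy net (x_l), write L c for the limit of d c x_l along the net; a
    point z is a limit of the net exactly when d c z = L c for every c.  Such a z
    is obtained as the d-maximum of a set Y of points y with L y small that come
    arbitrarily close to the net from above:
    - (1) Y consists of the y lying uniformly below neighbourhoods of a tail;
    - (2) Y = {L < eps} only gives d c z <= L c <= d c z + eps, and the points z
      obtained for eps = 2^-n form a Cauchy sequence whose limit is exact;
    - (3) Y = {L = 0}, since iterating the first hypothesis along a geometric
      sequence moves any point with small L to an e-close point with L = 0;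
    - (4) separability replaces the net by a sequence that converges as fast as
      desired, and the same iteration turns it into an e-close sequence increasing
      for the preorder d = 0, which is Y. *)
Require Import Defs.
From mathcomp Require Import all_boot all_order all_algebra.
From mathcomp Require Import all_classical all_reals all_analysis.
From mathcomp Require Import lra.

Set Implicit Arguments.
Unset Strict Implicit.
Unset Printing Implicit Defensive.

Import Order.TTheory GRing.Theory Num.Theory.
Import numFieldNormedType.Exports.

Local Open Scope classical_set_scope.
Local Open Scope ereal_scope.

(** * Truncated subtraction and the epsilon-delta form of the uniform preorder *)

Section ExtendedReals.
Context {R : realType}.
Implicit Types (a b t : \bar R) (S : set (\bar R)).

Lemma sup_nneg_ge0 S : 0 <= sup_nneg S.
Proof. by apply: ereal_sup_ubound; left. Qed.

Lemma sup_nneg_ub S a : S a -> a <= sup_nneg S.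
Proof. by move=> Sa; apply: ereal_sup_ubound; right. Qed.

Lemma sup_nneg_le S t : 0 <= t -> (forall a, S a -> a <= t) -> sup_nneg S <= t.
Proof. by move=> t0 h; apply: ge_ereal_sup => a [->//|/h]. Qed.

(** This adjunction turns bounds on [dist_over] and [dist_under] into triangle-type inequalities.
    For infinite [b] both sides hold, since [oo - oo] is truncated to 0. *)
Lemma trunc_sub_le a b t : 0 <= a -> 0 <= b -> 0 <= t ->
  (trunc_sub a b <= t) = (a <= b + t).
Proof.
move=> a0 b0 t0; rewrite /trunc_sub ge_max t0 andbT.
case: b b0 => [b| |] // b0; first by rewrite leeBlDl.
rewrite addeNy leNye addye ?leey//.
by rewrite -ltNye (lt_le_trans _ t0)// ltNy0.
Qed.

Lemma lte_half_add a b (eps : R) :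
  a < (eps / 2)%:E -> b < (eps / 2)%:E -> a + b < eps%:E.
Proof. by move=> ha hb; rewrite [eps]splitr EFinD lteD. Qed.

Lemma ge0_lte_addr a (eps : R) : 0 <= a -> a != +oo -> (0 < eps)%R -> a < a + eps%:E.
Proof. by move=> a0 ay e0; rewrite lteDl ?lte_fin// ge0_fin_numE// ltey. Qed.

Lemma expr_half_small (c eps : R) : (0 < c)%R -> (0 < eps)%R ->
  exists N, forall n, (N <= n)%N -> (c / 2 ^+ n < eps)%R.
Proof.
move=> c0 e0.
have := @cvg_geometric R c (2^-1)%R.
rewrite gtr0_norm ?invr_gt0 // invf_lt1 ?ltr1n // => /(_ isT) /cvgrPdist_lt /(_ _ e0).
case=> N _ hN; exists N => n /hN /=.
by rewrite sub0r normrN /geometric /= exprVn gtr0_norm// divr_gt0// exprn_gt0.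
Qed.

Lemma eq0_le_eps a : 0 <= a -> (forall eps : R, (0 < eps)%R -> a <= eps%:E) -> a = 0.
Proof.
move=> a0 h; apply/eqP; rewrite eq_le a0 andbT; apply/lee_addgt0Pr => eps e0.
by rewrite add0e; apply: h.
Qed.

(* Apply the hypothesis to the set of pairs where f is at least eps. *)
Lemma precapprox_small {A B : Type} (f g : A -> B -> \bar R) :
  (forall x y, 0 <= g x y) -> precapprox f g ->
  forall eps : R, (0 < eps)%R -> exists2 del : R, (0 < del)%R &
    forall x y, g x y < del%:E -> f x y < eps%:E.
Proof.
move=> g0 fg eps e0; pose Z : set (A * B) := [set p | eps%:E <= f p.1 p.2].
have [h|] := eqVneq (ereal_inf [set g p.1 p.2 | p in Z]) 0.
  have : eps%:E <= ereal_inf [set f p.1 p.2 | p in Z].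
    by apply: le_ereal_inf_tmp => _ [p Zp <-].
  by rewrite (fg _ h) lee_fin leNgt e0.
have i0 : 0 <= ereal_inf [set g p.1 p.2 | p in Z].
  by apply: le_ereal_inf_tmp => _ [p Zp <-].
move=> hn0; have [del d0 hd] : exists2 del : R, (0 < del)%R &
    del%:E <= ereal_inf [set g p.1 p.2 | p in Z].
  case: (ereal_inf _) i0 hn0 => [r| |] //=; last by exists 1%R => //; rewrite leey.
  by rewrite lee_fin => r0 rn0; exists r => //; rewrite lt_neqAle eq_sym r0 andbT.
exists del => // a b gd; rewrite ltNge; apply/negP => Zab; move: gd.
rewrite ltNge; apply/negP/negPn; apply: le_trans hd _.
by apply: ereal_inf_lbound; exists (a, b).
Qed.

End ExtendedReals.

(** * Triangle inequalities for the derived distances, and witnesses for compositions *)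

Section Distances.
Context {R : realType} {X : Type}.
Implicit Types (d e : X -> X -> \bar R) (x y z : X).

Lemma dist_ge0 d : is_distance d -> forall x y, 0 <= d x y.
Proof. by case. Qed.

Lemma dist_triangle d : is_distance d -> forall z x y, d x y <= d x z + d z y.
Proof. by case=> _ h z x y. Qed.

Lemma dist_over_ge0 d x y : 0 <= dist_over d x y.
Proof. exact: sup_nneg_ge0. Qed.

Lemma dist_under_ge0 d x y : 0 <= dist_under d x y.
Proof. exact: sup_nneg_ge0. Qed.

Lemma dist_over_triangle d : is_distance d ->
  forall z x y, d x y <= dist_over d x z + d z y.
Proof.
move=> hd z x y; rewrite addeC -trunc_sub_le ?(dist_ge0 hd) ?dist_over_ge0//.
by apply: sup_nneg_ub; exists y.
Qed.

Lemma dist_under_triangle d : is_distance d ->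
  forall z x y, d x y <= d x z + dist_under d z y.
Proof.
move=> hd z x y; rewrite -trunc_sub_le ?(dist_ge0 hd) ?dist_under_ge0//.
by apply: sup_nneg_ub; exists x.
Qed.

Lemma dist_under_le d z y t : is_distance d -> 0 <= t ->
  (forall x, d x y <= d x z + t) -> dist_under d z y <= t.
Proof.
move=> hd t0 h; apply: sup_nneg_le => // _ [x _ <-].
by rewrite trunc_sub_le ?(dist_ge0 hd).
Qed.

Lemma dist_under_refl d x : is_distance d -> dist_under d x x = 0.
Proof.
move=> hd; apply/eqP; rewrite eq_le dist_under_ge0 andbT.
by apply: dist_under_le => // y; rewrite adde0.
Qed.

Lemma is_distance_under d : is_distance d -> is_distance (dist_under d).
Proof.
move=> hd; split=> [x y|x y z]; first exact: dist_under_ge0.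
apply: dist_under_le => // [|w]; first by rewrite adde_ge0// dist_under_ge0.
rewrite addeA; apply: le_trans (dist_under_triangle hd z _ _) _.
by rewrite leeD2r// dist_under_triangle.
Qed.

Lemma is_distance_sym d : is_distance d -> is_distance (dist_sym d).
Proof.
move=> hd; split=> [x y|x y z]; first by rewrite /dist_sym le_max dist_ge0.
rewrite {1}/dist_sym ge_max; apply/andP; split.
  apply: le_trans (dist_triangle hd z _ _) _.
  by rewrite leeD// /dist_sym le_max lexx.
apply: le_trans (dist_triangle hd z _ _) _; rewrite addeC.
by rewrite leeD// /dist_sym le_max lexx orbT.
Qed.

(** The relation contributes only 0 or [+oo], so a term of the infimum below [t < +oo] can only come
    from a related point. *)
Lemma dist_comp_rel_ltr {A B C : Type} (f : A -> C -> \bar R) (r : C -> B -> Prop)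
    a b (t : \bar R) :
  t < +oo ->
  (forall a c, 0 <= f a c) ->
  dist_comp f (rel_dist r) a b < t -> exists2 c, f a c < t & r c b.
Proof.
move=> ty f0 /ereal_inf_lt[_ [c _ <-]]; rewrite /rel_dist.
case: asboolP => [rcb|_]; first by rewrite adde0; exists c.
by rewrite addey ?lt_neqAle ?leye_eq; [case: t ty | case: (f a c) (f0 a c)].
Qed.

Lemma dist_comp_rel_ltl {A B C : Type} (r : A -> C -> Prop) (f : C -> B -> \bar R)
    a b (t : \bar R) :
  t < +oo ->
  (forall c b, 0 <= f c b) ->
  dist_comp (rel_dist r) f a b < t -> exists2 c, r a c & f c b < t.
Proof.
move=> ty f0 /ereal_inf_lt[_ [c _ <-]]; rewrite /rel_dist.
case: asboolP => [rcb|_]; first by rewrite add0e; exists c.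
by rewrite addye; [case: t ty | case: (f c b) (f0 c b)].
Qed.

(** One term of the supremum suffices: with [n > eps / eta], a total cost below [eps] leaves
    [f z y < eps / n < eta]. *)
Lemma comp_Phi_lt e f x y (eps eta : R) : (forall x y, 0 <= e x y) ->
  (forall x y, 0 <= f x y) -> (0 < eta)%R ->
  comp_Phi e f x y < eps%:E -> exists2 z, e x z < eps%:E & f z y < eta%:E.
Proof.
move=> e0 f0 eta0 h; pose n := (Num.truncn (eps / eta)).+1.
have : dist_comp e (fun x y => n%:R%:E * f x y) x y < eps%:E.
  by apply: le_lt_trans h; apply: sup_nneg_ub; exists n.
have n0 : (0 < n%:R :> R)%R by rewrite ltr0n.
case/ereal_inf_lt => _ [z _ <-] hz; exists z.
  by apply: le_lt_trans hz; rewrite leeDl// mule_ge0// lee_fin ltW.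
have : n%:R%:E * f z y < eps%:E by apply: le_lt_trans hz; rewrite leeDr.
case: (f z y) (f0 z y) => [r| |] //=; last by rewrite gt0_muley ?lte_fin.
move=> _; rewrite -EFinM !lte_fin => hr; rewrite -(ltr_pM2l n0).
apply: lt_trans hr _; rewrite -ltr_pdivrMr//.
exact: truncnS_gt.
Qed.

End Distances.

(** * Nets as filters of tails *)

Section Nets.
Context {L : Type} {prec : L -> L -> Prop}.
Hypothesis hL : net_index prec.

Lemma net_tails_proper : ProperFilter (net_tails prec).
Proof.
case: hL => [[l0] tr dir]; split; last split.
(* As [prec] may be irreflexive, directedness at the pair [g], [g] provides a point beyond [g]. *)
- by case=> g h; have [c [gc _]] := dir g g; apply: h gc.
- by exists l0.
- move=> P Q [a ha] [b hb]; have [c [ac bc]] := dir a b.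
  by exists c => l cl; split; [apply: ha|apply: hb]; apply: tr cl.
- by move=> P Q PQ [a ha]; exists a => l /ha /PQ.
Qed.

Lemma near_tail g : \forall l \near net_tails prec, prec g l.
Proof. by exists g. Qed.

End Nets.

Lemma filter_finite {T X : Type} (F : set_system T) (A : set X) (P : X -> T -> Prop)
    {FF : Filter F} :
  finite_set A -> (forall a, A a -> \forall l \near F, P a l) ->
  \forall l \near F, forall a, A a -> P a l.
Proof.
move=> fA; have [s ->] := (finite_seqP (T := {classic X}) A).1 fA.
elim: s => [|b s IH] h; first by apply: nearW.
have h1 : \forall l \near F, P b l by apply: h; rewrite /= mem_head.
have h2 : \forall l \near F, forall a : {classic X}, a \in s -> P a l.
  by apply: IH => a sa; apply: h; rewrite /= in_cons sa orbT.
apply: filterS2 h1 h2 => l Pb Ps a /=.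
by rewrite in_cons => /orP[/eqP->|/Ps].
Qed.

Lemma open_subbase {X : Type} (S : set (set X)) (O : set X) :
  S O -> open (O : set (subbase_space S)).
Proof.
move=> SO; exists [set O]; last by rewrite bigcup_set1.
by move=> _ ->; apply: (@finI_from1 _ _ S (fun O : set X => O)).
Qed.

Lemma net_cvgP {X L : Type} (S : set (set X)) (prec : L -> L -> Prop) (x : L -> X) p :
  net_index prec ->
  net_cvg S prec x p <->
  (forall O, S O -> O p -> \forall l \near net_tails prec, O (x l)).
Proof.
move=> hL; have FF := net_tails_proper hL; split=> [h O SO Op|h].
  by apply: h; apply: open_nbhs_nbhs; split => //; apply: open_subbase.
move=> A; rewrite nbhsE => -[B [[D sD <-] [C DC Cp]] sB].
apply: (@filterS _ _ _ (fun l => C (x l))); first by move=> l Cl; apply: sB; exists C.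
have [E sE CE] := sD _ DC; rewrite -CE in Cp *.
apply: (@filter_bigI _ _ E (fun O l => O (x l))) => O OE.
by apply: h; [have := sE _ OE; rewrite inE|apply: Cp].
Qed.

Lemma net_cauchyP {R : realType} {X L : Type} (d : X -> X -> \bar R)
    (prec : L -> L -> Prop) (x : L -> X) : net_index prec ->
  net_cauchy d prec x <->
  (forall eps : R, (0 < eps)%R -> \forall g \near net_tails prec,
     forall l, prec g l -> d (x g) (x l) <= eps%:E).
Proof.
move=> hL; have FF := net_tails_proper hL.
split=> [h eps e0|h].
  have : \forall g \near net_tails prec,
      sup_nneg [set d (x g) (x l) | l in prec g] < eps%:E.
    by apply: (h (fun u => u < eps%:E)); apply: open_ereal_lt'; rewrite lte_fin.
  apply: filterS => g /= hg l gl; apply: le_trans (ltW hg).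
  by apply: sup_nneg_ub; exists l.
move=> A [r /= r0 hA].
(* The bound on the tail supremum will only be non-strict, hence the halved radius. *)
have r20 : (0 < r / 2)%R by rewrite divr_gt0.
have := h _ r20; apply: filterS => g hg.
have {hg} : sup_nneg [set d (x g) (x l) | l in prec g] <= (r / 2)%:E.
  apply: sup_nneg_le => [|_ [l gl <-]]; last exact: hg.
  by rewrite lee_fin ltW.
have := sup_nneg_ge0 [set d (x g) (x l) | l in prec g].
rewrite /=; case: (sup_nneg _) => [s| |] //; rewrite !lee_fin => s0 sr.
apply: hA => /=; rewrite sub0r normrN ger0_norm//.
by apply: le_lt_trans sr _; lra.
Qed.

(** * The limit of distances to a net, compared with distances to a d-maximum *)

Section UpperLimit.
Context {R : realType} {X L : Type} (d : X -> X -> \bar R)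
  (prec : L -> L -> Prop) (x : L -> X).
Hypotheses (hd : is_distance d) (hL : net_index prec).
Let FF : ProperFilter (net_tails prec) := net_tails_proper hL.
Local Existing Instance FF.

(** This is the limsup of [d c (x l)]. For a d-Cauchy net it is the limit, because
    [d c (x m) <= d c (x l) + d (x l) (x m)]. *)
Definition upper_limit (c : X) : \bar R :=
  ereal_inf [set sup_nneg [set d c (x l) | l in prec g] | g in [set: L]].

Lemma upper_limit_ge0 c : 0 <= upper_limit c.
Proof. by apply: le_ereal_inf_tmp => _ [g _ <-]; apply: sup_nneg_ge0. Qed.

Lemma near_upper_limit_lt c t : upper_limit c < t ->
  \forall l \near net_tails prec, d c (x l) < t.
Proof.
case/ereal_inf_lt => _ [g _ <-] h; exists g => l gl.
by apply: le_lt_trans h; apply: sup_nneg_ub; exists l.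
Qed.

Lemma upper_limit_le c t : 0 <= t ->
  (\forall l \near net_tails prec, d c (x l) <= t) -> upper_limit c <= t.
Proof.
move=> t0 [g h]; have : sup_nneg [set d c (x l) | l in prec g] <= t.
  by apply: sup_nneg_le => // _ [l gl <-]; apply: h.
by apply: le_trans; apply: ereal_inf_lbound; exists g.
Qed.

(** The common source of the triangle inequalities through [d b c] and through [dist_over d b c]. A
    strict bound on a tail needs some room [eps], hence the separate case of an infinite limit. *)
Lemma upper_limit_shift b c t : 0 <= t ->
  (forall y, d b y <= t + d c y) -> upper_limit b <= t + upper_limit c.
Proof.
move=> t0 h; apply/lee_addgt0Pr => eps e0; rewrite -addeA.
have c0 := upper_limit_ge0 c.
apply: upper_limit_le.
  by rewrite !adde_ge0// lee_fin ltW.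
have [cy|cy] := eqVneq (upper_limit c) +oo.
  apply: nearW => l; rewrite cy addye// addey ?leey//.
  by rewrite -ltNye (lt_le_trans _ t0)// ltNy0.
have : upper_limit c < upper_limit c + eps%:E.
  exact: ge0_lte_addr.
move/near_upper_limit_lt; apply: filterS => l hl.
by apply: le_trans (h _) _; rewrite leeD2l// ltW.
Qed.

Lemma upper_limit_triangle b c : upper_limit b <= d b c + upper_limit c.
Proof. by apply: upper_limit_shift => [|y]; rewrite ?(dist_ge0 hd)// dist_triangle. Qed.

Lemma upper_limit_over_triangle b c :
  upper_limit b <= dist_over d b c + upper_limit c.
Proof.
by apply: upper_limit_shift => [|y]; rewrite ?dist_over_ge0// dist_over_triangle.
Qed.

Lemma near_upper_limit_small : net_cauchy d prec x -> forall eps : R, (0 < eps)%R ->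
  \forall l \near net_tails prec, upper_limit (x l) <= eps%:E.
Proof.
move=> /(net_cauchyP _ _ hL) h eps e0; have := h _ e0; apply: filterS => g hg.
by apply: upper_limit_le; [rewrite lee_fin ltW|exists g].
Qed.

(** Balls need only the limsup bound. For holes, [d c (x l)] cannot drop late in the net, because
    [upper_limit c <= d c (x l) + upper_limit (x l)] and the last term tends to 0. *)
Lemma cvg_upper_limit z : net_cauchy d prec x ->
  (forall c, d c z = upper_limit c) ->
  net_cvg (sub_upper_ball d `|` sub_lower_hole d) prec x z.
Proof.
move=> hx hz; apply/net_cvgP => // O [] [c [r [r0 ->]]] /=; rewrite hz.
  exact: near_upper_limit_lt.
move=> rc; have [eps e0 re] : exists2 eps : R, (0 < eps)%R & r%:E + eps%:E < upper_limit c.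
  case: (upper_limit c) rc => [s| |]//; last by exists 1%R; rewrite // ltry.
  rewrite lte_fin => rs; exists ((s - r) / 2)%R; first by rewrite divr_gt0 ?subr_gt0.
  by rewrite -EFinD lte_fin; lra.
have := near_upper_limit_small hx e0; apply: filterS => l hl.
rewrite ltNge; apply/negP => cl; move: re; apply/negP; rewrite -leNgt.
by apply: le_trans (upper_limit_triangle _ (x l)) _; apply: leeD.
Qed.

(** Triangle inequality through each [y] of [Y], followed by the infimum clause of a d-maximum. *)
Lemma maximum_ge_upper_limit Y z (eps : R) : dist_maximum d Y z ->
  (forall y, Y y -> upper_limit y <= eps%:E) ->
  forall c, upper_limit c <= d c z + eps%:E.
Proof.
move=> [_ hz] hY c; apply: le_trans (leeD2r _ (hz c)).
rewrite -leeBlDr//; apply: le_ereal_inf_tmp => _ [y Yy <-].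
rewrite leeBlDr//; apply: le_trans (upper_limit_triangle _ y) _.
by rewrite leeD2l// hY.
Qed.

(** Here the other clause of a d-maximum counts: [d y z = 0] gives [d c z <= d c y], and some [y] is
    almost as close to [c] as a late [x l]. *)
Lemma maximum_le_upper_limit Y z : dist_maximum d Y z ->
  (forall eps : R, (0 < eps)%R -> \forall l \near net_tails prec,
     exists2 y, Y y & forall c, d c y <= d c (x l) + eps%:E) ->
  forall c, d c z <= upper_limit c.
Proof.
move=> [Yz _] hY c; apply/lee_addgt0Pr => eps e0.
have [->|cy] := eqVneq (upper_limit c) +oo; first by rewrite addye ?leey.
have e2 : (0 < eps / 2)%R by rewrite divr_gt0.
have hc : upper_limit c < upper_limit c + (eps / 2)%:E.
  exact: ge0_lte_addr (upper_limit_ge0 _) cy e2.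
have [l [hl [y Yy hy]]] := @filter_ex _ _ FF _ (filterI (near_upper_limit_lt hc) (hY _ e2)).
apply: le_trans (dist_triangle hd y _ _) _; rewrite (Yz _ Yy) adde0.
apply: le_trans (hy c) _.
have -> : eps%:E = (eps / 2)%:E + (eps / 2)%:E by rewrite -EFinD -splitr.
rewrite addeA leeD2r//; exact: ltW.
Qed.

Lemma near_under_le (Y : set X) :
  (forall eps : R, (0 < eps)%R -> \forall l \near net_tails prec,
     exists2 y, Y y & dist_under d (x l) y <= eps%:E) ->
  (forall eps : R, (0 < eps)%R -> \forall l \near net_tails prec,
     exists2 y, Y y & forall c, d c y <= d c (x l) + eps%:E).
Proof.
move=> h eps e0; have := h _ e0; apply: filterS => l [y Yy hy].
exists y => // c; apply: le_trans (dist_under_triangle hd (x l) _ _) _.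
by rewrite leeD2l.
Qed.

End UpperLimit.

(** * Limits of geometrically fast chains *)

Lemma divXS {R : realType} (c : R) n : (c / 2 ^+ n.+1 = c / 2 ^+ n / 2)%R.
Proof. by rewrite exprS invfM mulrA mulrAC. Qed.

Lemma net_index_ltn : net_index (fun m n => m < n)%N.
Proof.
split; first exact: inhabits 0%N.
- by move=> a b c; apply: ltn_trans.
- by move=> a b; exists (maxn a b).+1; rewrite !ltnS leq_maxl leq_maxr.
Qed.

(** Limits in the hole topology keep upper bounds: if [e (y n) z] exceeded [eps / 2 ^+ n], so would
    [e (y n) (y m)] for late [m]. *)
Lemma geometric_chain_limit {R : realType} {X : Type} (e : X -> X -> \bar R)
    (y : nat -> X) (eps : R) :
  is_distance e -> net_complete e (sub_lower_hole e) -> (0 < eps)%R ->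
  (forall n, e (y n) (y n.+1) <= (eps / 2 ^+ n.+1)%:E) ->
  exists z, forall n, e (y n) z <= (eps / 2 ^+ n)%:E.
Proof.
move=> he ce e0 hy; have FF := net_tails_proper net_index_ltn.
have p0 n : (0 < eps / 2 ^+ n)%R by rewrite divr_gt0// exprn_gt0.
(* The exact partial sum of the geometric series makes the induction close. *)
have hyk n k : e (y n) (y (n + k).+1) <= (eps / 2 ^+ n - eps / 2 ^+ (n + k).+1)%:E.
  elim: k => [|k IH].
    by rewrite addn0; apply: le_trans (hy n) _; rewrite lee_fin divXS; lra.
  rewrite addnS; apply: le_trans (dist_triangle he (y (n + k).+1) _ _) _.
  apply: le_trans (leeD IH (hy _)) _; rewrite -EFinD lee_fin.
  by rewrite (divXS _ (n + k).+1); lra.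
have hyn n m : (n < m)%N -> e (y n) (y m) <= (eps / 2 ^+ n)%:E.
  move=> nm; have := hyk n (m - n.+1)%N; rewrite -addSn subnKC//.
  by move/le_trans; apply; rewrite lee_fin; have := p0 m; lra.
have cy : net_cauchy e (fun m n => m < n)%N y.
  apply/(net_cauchyP _ _ net_index_ltn) => del d0.
  have [N hN] := expr_half_small e0 d0.
  exists N => n Nn m nm; apply: le_trans (hyn _ _ nm) _.
  by rewrite lee_fin ltW// hN// ltnW.
have [z /(net_cvgP _ _ _ net_index_ltn) hz] := ce _ _ _ net_index_ltn cy.
exists z => n; rewrite leNgt; apply/negP => lt.
have /hz /(_ lt) /(filterI (near_tail n)) /(@filter_ex _ _ FF) [m [nm]] :
  sub_lower_hole e [set w | (eps / 2 ^+ n)%:E < e (y n) w] by exists (y n), (eps / 2 ^+ n)%R.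
by rewrite /= ltNge hyn.
Qed.

(** * Conditions (1) and (2): order-directed sets *)

Section OrderDirected.
Context {R : realType} {X L : Type} (d : X -> X -> \bar R)
  (prec : L -> L -> Prop) (x : L -> X).
Hypotheses (hd : is_distance d) (hL : net_index prec) (hx : net_cauchy d prec x).
Let FF : ProperFilter (net_tails prec) := net_tails_proper hL.
Local Existing Instance FF.

Lemma upper_limit_attained_lt_rel :
  precapprox (dist_comp (dist_under d) (rel_dist (le_rel (dist_set d)))) (dist_set d) ->
  (forall Y : set X, rel_directed (lt_rel d) Y -> exists z, dist_maximum d Y z) ->
  exists z, forall c, d c z = upper_limit d prec x c.
Proof.
move=> /precapprox_small small hmax.
(* One radius [eta] serves all late [l]; this uniformity makes [Y] directed for [lt_rel d]. *)
pose Y : set X := [set y | exists2 eta : R, (0 < eta)%R &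
  \forall l \near net_tails prec,
    forall z, dist_under d (x l) z < eta%:E -> d y z = 0].
have nearY (eps : R) : (0 < eps)%R -> \forall g \near net_tails prec,
    exists2 w, Y w & dist_under d (x g) w < eps%:E.
  move=> e0; have [||del d0 hdel] := small _ eps => //.
    by move=> *; apply: sup_nneg_ge0.
  have d4 : (0 < del / 4)%R by rewrite divr_gt0.
  have := (net_cauchyP _ _ hL).1 hx _ d4; apply: filterS => g hg.
  (* [Z] is the union of the balls around the points after [g]. It lies within [del / 4 + del / 4]
     of [x g], so some [w] near [x g] is exactly below all of [Z], and hence in [Y]. *)
  pose Z : set X := [set z | exists2 l, prec g l & dist_under d (x l) z < (del / 4)%:E].
  have : dist_set d (x g) Z < del%:E.
    apply: (@le_lt_trans _ _ (del / 2)%:E); last by rewrite lte_fin; lra.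
    apply: sup_nneg_le => [|_ [z [l gl lz] <-]]; first by rewrite lee_fin; lra.
    apply: le_trans (dist_under_triangle hd (x l) _ _) _.
    have -> : (del / 2)%:E = (del / 4)%:E + (del / 4)%:E by rewrite -EFinD; congr EFin; lra.
    by apply: leeD (hg _ gl) (ltW lz).
  have u0 := @dist_under_ge0 _ _ d.
  move/hdel/(dist_comp_rel_ltr (ltry _) u0) => [w wg wZ].
  exists w => //; exists (del / 4)%R => //; exists g => l gl z lz.
  apply/eqP; rewrite eq_le (dist_ge0 hd) andbT -wZ.
  by apply: sup_nneg_ub; exists z => //; exists l.
have [z maxz] : exists z, dist_maximum d Y z.
  apply: hmax => F fF FY.
  (* Membership in [Y] persists for smaller radii, so the finite set [F] has a common one. *)
  have hF : \forall eta \near (0 : R)^'+, forall y, F y ->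
      \forall l \near net_tails prec,
        forall z, dist_under d (x l) z < eta%:E -> d y z = 0.
    apply: filter_finite fF _ => y /FY [eta eta0 h].
    have := nbhs_right_lt eta0; apply: filterS => r r_eta.
    apply: filterS h => l h z lz; apply: h; apply: lt_trans lz _.
    by rewrite lte_fin.
  have [eta [eta0 heta]] := filter_ex (filterI (nbhs_right_gt (0 : R)) hF).
  have eta2 : (0 < eta / 2)%R by rewrite divr_gt0.
  have [g [Fg [w Yw gw]]] := filter_ex (filterI (filter_finite fF heta) (nearY _ eta2)).
  (* The ball of radius [eta / 2] around [w] stays inside the ball of radius [eta] around [x g]. *)
  exists w => // y Fy; exists (eta / 2)%R; split=> // z wz; apply: Fg => //.
  apply: le_lt_trans (dist_triangle (is_distance_under hd) w _ _) _.
  exact: lte_half_add.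
exists z => c; apply/eqP; rewrite eq_le; apply/andP; split.
  apply: (maximum_le_upper_limit hd hL maxz); apply: near_under_le => // eps e0.
  by apply: filterS (nearY _ e0) => l [w Yw /ltW]; exists w.
(* A late [x l] lies in its own ball, so every point of [Y] has upper limit 0. *)
rewrite -[d c z]adde0; apply: (maximum_ge_upper_limit hd hL maxz) => y [eta eta0 h].
apply: upper_limit_le => //; apply: filterS h => l h.
by rewrite h// dist_under_refl// lte_fin.
Qed.

(** The sublevel set [Y] contains the late points of the net, so the first inequality loses nothing;
    [eps] enters only in the second. *)
Lemma upper_limit_approximated (eps : R) : (0 < eps)%R ->
  (forall (F : finsub X) (y : X),
     dist_comp (rel_dist (le_rel (finset_dist d))) (dist_over d) F y <= finset_dist d F y) ->
  (forall Y : set X, rel_directed (le_rel d) Y -> exists z, dist_maximum d Y z) ->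
  exists z, forall c, d c z <= upper_limit d prec x c /\
                      upper_limit d prec x c <= d c z + eps%:E.
Proof.
move=> e0 hF hmax; pose Y : set X := [set y | upper_limit d prec x y < eps%:E].
have [z maxz] : exists z, dist_maximum d Y z.
  apply: hmax => F fF FY.
  have Flt : \forall r \near eps^'-, forall y, F y -> upper_limit d prec x y < r%:E.
    apply: filter_finite fF _ => y /FY; rewrite /Y /=.
    have := upper_limit_ge0 d prec x y.
    by case: (upper_limit _ _ _ _) => [s| |] // _; rewrite lte_fin; apply: nbhs_left_gt.
  have [r [[r0 re] hr]] :=
    filter_ex (filterI (filterI (nbhs_left_gt e0) (nbhs_left_lt eps)) Flt).
  (* One quarter of the gap [eps - r] makes the bound on the infimum strict, another bounds the
     upper limit at [x l]; the total stays below [eps]. *)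
  have s0 : (0 < (eps - r) / 4)%R by lra.
  have [l [hl1 hl2]] := filter_ex (filterI
    (filter_finite fF (fun y Fy => near_upper_limit_lt (hr y Fy)))
    (near_upper_limit_small hL hx s0)).
  have := hF (exist _ F fF) (x l).
  have : finset_dist d (exist _ F fF) (x l) <= r%:E.
    apply: sup_nneg_le => [|_ [y Fy <-]]; first by rewrite lee_fin ltW.
    exact/ltW/hl1.
  move=> /[swap] /le_trans /[apply] h.
  have o0 := @dist_over_ge0 _ _ d.
  have /(dist_comp_rel_ltl (ltry _) o0) [w Fw wl] :
      dist_comp (rel_dist (le_rel (finset_dist d))) (dist_over d) (exist _ F fF) (x l)
      < (r + (eps - r) / 4)%:E.
    by apply: le_lt_trans h _; rewrite lte_fin; lra.
  exists w.
    apply: le_lt_trans (upper_limit_over_triangle x hd hL w (x l)) _.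
    apply: (@lt_le_trans _ _ ((r + (eps - r) / 4)%:E + ((eps - r) / 4)%:E)).
      apply: lte_leD => //; rewrite ge0_fin_numE ?upper_limit_ge0//.
      by rewrite (le_lt_trans hl2) ?ltry.
    by rewrite -EFinD lee_fin; lra.
  move=> y Fy; apply/eqP; rewrite eq_le (dist_ge0 hd) andbT -Fw.
  by apply: sup_nneg_ub; exists y.
exists z => c; split.
  apply: (maximum_le_upper_limit hd hL maxz) => del d0.
  have e2 : (0 < eps / 2)%R by lra.
  have := near_upper_limit_small hL hx e2; apply: filterS => l hl.
  exists (x l) => [|b]; last by rewrite leeDl// lee_fin ltW.
  by apply: le_lt_trans hl _; rewrite lte_fin; lra.
by apply: (maximum_ge_upper_limit hd hL maxz) => y /ltW.
Qed.

Lemma upper_limit_attained_finset :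
  (forall (F : finsub X) (y : X),
     dist_comp (rel_dist (le_rel (finset_dist d))) (dist_over d) F y <= finset_dist d F y) ->
  (forall Y : set X, rel_directed (le_rel d) Y -> exists z, dist_maximum d Y z) ->
  net_complete (dist_sym (dist_under d)) (sub_lower_hole (dist_sym (dist_under d))) ->
  exists z, forall c, d c z = upper_limit d prec x c.
Proof.
move=> hF hmax hc.
have p0 n : (0 < 1 / 2 ^+ n :> R)%R by rewrite divr_gt0// exprn_gt0.
(* Precision [1 / 2 ^+ n.+1] at index [n] is the step length required by [geometric_chain_limit] for
   [eps = 1]. *)
have /choice [y hy] n := upper_limit_approximated (p0 n.+1) hF hmax.
have hsym := is_distance_sym (is_distance_under hd).
have [|z hz] := geometric_chain_limit (y := y) hsym hc ltr01.
  move=> n; have q0 := p0 n.+1; rewrite ge_max /dist_op.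
  apply/andP; split; apply: dist_under_le => // c.
    exact: le_trans (hy _ _).1 (hy _ _).2.
  apply: le_trans (hy _ _).1 _; apply: le_trans (hy n.+1 _).2 _.
  by rewrite leeD2l// lee_fin (divXS _ n.+1); lra.
have zy (eps : R) : (0 < eps)%R -> exists n, (1 / 2 ^+ n < eps)%R.
  by move=> e0; have [N hN] := expr_half_small ltr01 e0; exists N; apply: hN.
(* Each half of the symmetrized distance between [y n] and [z] serves one inequality. *)
exists z => c; apply/eqP; rewrite eq_le; apply/andP; split; apply/lee_addgt0Pr => eps e0.
  have [n hn] := zy _ e0; apply: le_trans (dist_under_triangle hd (y n) _ _) _.
  apply: leeD (hy _ _).1 _; apply: (@le_trans _ _ (1 / 2 ^+ n)%:E); last by rewrite lee_fin ltW.
  by apply: le_trans (hz n); rewrite le_max lexx.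
have e2 : (0 < eps / 2)%R by lra.
have [n hn] := zy _ e2; apply: le_trans (hy n _).2 _.
have -> : eps%:E = (eps / 2)%:E + (eps / 2)%:E by rewrite -EFinD -splitr.
rewrite addeA; apply: leeD.
  apply: le_trans (dist_under_triangle hd z _ _) _; rewrite leeD2l//.
  apply: (@le_trans _ _ (1 / 2 ^+ n)%:E); last by rewrite lee_fin ltW.
  by apply: le_trans (hz n); rewrite le_max lexx orbT.
by rewrite lee_fin divXS; have := p0 n; lra.
Qed.

End OrderDirected.

(** * Conditions (3) and (4): iterated e-small corrections *)

Section ApproximatingDistance.
Context {R : realType} {X : Type} (d e : X -> X -> \bar R).
Hypotheses (hd : is_distance d) (he : is_distance e).
Hypothesis under_e : precapprox (dist_under d) e.
Hypothesis over_e : precapprox (dist_op (dist_over d)) e.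
Hypothesis ce : net_complete e (sub_lower_hole e).

Lemma eventually_under_small (c eps : R) (x y : nat -> X) :
  (0 < c)%R -> (0 < eps)%R ->
  (forall n, e (x n) (y n) <= (c / 2 ^+ n)%:E) ->
  exists N, forall n, (N <= n)%N ->
    dist_under d (x n) (y n) < eps%:E /\ dist_over d (y n) (x n) < eps%:E.
Proof.
move=> c0 e0 hxy.
have [del1 d10 h1] := precapprox_small (dist_ge0 he) under_e e0.
have [del2 d20 h2] := precapprox_small (dist_ge0 he) over_e e0.
have [N1 hN1] := expr_half_small c0 d10.
have [N2 hN2] := expr_half_small c0 d20.
exists (maxn N1 N2) => n; rewrite geq_max => /andP[n1 n2].
split; [apply: h1|apply: h2]; apply: le_lt_trans (hxy n) _; rewrite lte_fin.
  exact: hN1.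
exact: hN2.
Qed.

(* m is a modulus independent of f: it is applied both to an upper limit and to
   all the functions d^~ y at once. *)
Lemma exists_near_zero (f : X -> \bar R) (m : R -> R) :
  (forall a, 0 <= f a) -> (forall a b, f a <= dist_over d a b + f b) ->
  (forall eps : R, (0 < eps)%R -> (0 < m eps)%R) ->
  (forall eps : R, (0 < eps)%R -> forall x, f x < (m eps)%:E ->
     forall eta : R, (0 < eta)%R -> exists2 z, e x z < eps%:E & f z < eta%:E) ->
  forall eps : R, (0 < eps)%R -> forall x, f x < (m (eps / 2))%:E ->
    exists2 z, e x z <= eps%:E & f z = 0.
Proof.
move=> f0 fover m0 fm eps e0 x fx.
have p0 (c : R) n : (0 < c -> 0 < c / 2 ^+ n)%R by move=> c0; rewrite divr_gt0// exprn_gt0.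
(* Below the threshold [mu n], a move of e-length less than [eps / 2 ^+ n.+1] is available. *)
pose mu n := m (eps / 2 ^+ n.+1)%R.
have mu0 n : (0 < mu n)%R by apply: m0; apply: p0.
have step (p : nat * X) : exists z, f p.2 < (mu p.1)%:E ->
    [/\ e p.2 z < (eps / 2 ^+ p.1.+1)%:E, f z < (mu p.1.+1)%:E & f z < (1 / 2 ^+ p.1)%:E].
  case: p => n y /=; have [h|] := pselect (f y < (mu n)%:E); last by exists y.
  (* Nothing forces [mu] to tend to 0, so the bound [1 / 2 ^+ n] is imposed as well. *)
  have mn0 : (0 < Num.min (mu n.+1) (1 / 2 ^+ n))%R by rewrite lt_min mu0 p0.
  have [z yz] := fm _ (p0 _ n.+1 e0) _ h _ mn0.
  by rewrite EFin_min lt_min => /andP[fz1 fz2]; exists z.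
have [F hF] := choice step.
pose fix y n := if n is k.+1 then F (k, y k) else x.
have fy n : f (y n) < (mu n)%:E.
  elim: n => [|n IH]; first by rewrite /mu expr1.
  by have [] := hF (n, y n) IH.
have [|z hz] := geometric_chain_limit (y := y) he ce e0.
  by move=> n; have [/ltW] := hF (n, y n) (fy n).
exists z; first by have := hz 0%N; rewrite expr0 divr1.
apply: eq0_le_eps => // eta eta0; have eta2 : (0 < eta / 2)%R by rewrite divr_gt0.
have [N1 hN1] := expr_half_small ltr01 eta2.
have [N2 hN2] := eventually_under_small e0 eta2 hz.
pose n := maxn N1 N2.
apply: le_trans (fover _ (y n.+1)) _; apply/ltW/lte_half_add.
  by apply: (hN2 _ _).2; rewrite leqW// leq_maxr.
have [_ _ /lt_trans] := hF (n, y n) (fy n); apply.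
by rewrite lte_fin; apply: hN1; rewrite leq_maxl.
Qed.

Lemma upper_limit_attained_directed {L : Type} (prec : L -> L -> Prop) (x : L -> X) :
  net_index prec -> net_cauchy d prec x ->
  precapprox (comp_Phi e (dist_over d)) d ->
  (forall Y : set X, dist_directed d Y -> exists z, dist_maximum d Y z) ->
  exists z, forall c, d c z = upper_limit d prec x c.
Proof.
move=> hL hx /precapprox_small small hmax; have FF := net_tails_proper hL.
pose l := upper_limit d prec x.
have /choice [m hm] (eps : R) : exists del : R, (0 < eps)%R -> (0 < del)%R /\
    forall a b, d a b < del%:E -> forall eta : R, (0 < eta)%R ->
      exists2 z, e a z < eps%:E & dist_over d z b < eta%:E.
  have [e0|] := pselect (0 < eps)%R; last by exists 0%R.
  have [|del d0 h] := small _ _ e0; first exact: dist_ge0.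
  exists del => _; split=> // a b /h ab eta eta0.
  by apply: comp_Phi_lt eta0 ab; [exact: dist_ge0|exact: dist_over_ge0].
have nearl := near_upper_limit_small hL hx.
have near0 := @exists_near_zero l m.
have {}near0 : forall eps : R, (0 < eps)%R -> forall a, l a < (m (eps / 2))%:E ->
    exists2 z, e a z <= eps%:E & l z = 0.
  apply: near0 => [a|a b|eps /hm[]//|eps /hm[m0 h] a la eta eta0].
  - exact: upper_limit_ge0.
  - exact: upper_limit_over_triangle.
  (* The point moves close to a late [x g]: both [dist_over d z (x g)] and the upper limit at [x g]
     will be below [eta / 2]. *)
  have eta2 : (0 < eta / 2 / 2)%R by lra.
  have [g [ag gl]] := filter_ex (filterI (near_upper_limit_lt la) (nearl _ eta2)).
  have [z az zg] := h _ _ ag (eta / 2)%R ltac:(lra).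
  exists z => //; apply: le_lt_trans (upper_limit_over_triangle _ hd hL z (x g)) _.
  apply: lte_half_add => //; apply: le_lt_trans gl _.
  by rewrite lte_fin; lra.
pose Y : set X := [set y | l y = 0].
have underY (eps : R) : (0 < eps)%R -> exists2 del : R, (0 < del)%R &
    forall a, l a < del%:E -> exists2 y, Y y & dist_under d a y < eps%:E.
  move=> e0; have [del d0 h] := precapprox_small (dist_ge0 he) under_e e0.
  have d2 : (0 < del / 2)%R by lra.
  exists (m (del / 2 / 2))%R => [|a /(near0 _ d2)[z az z0]].
    by have [] := hm (del / 2 / 2)%R ltac:(lra).
  exists z => //; apply: h; apply: le_lt_trans az _; rewrite lte_fin; lra.
have nearY (eps : R) : (0 < eps)%R -> \forall g \near net_tails prec,
    exists2 y, Y y & dist_under d (x g) y < eps%:E.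
  move=> /underY[del d0 h]; have d2 : (0 < del / 2)%R by lra.
  apply: filterS (nearl _ d2) => g gl; apply: h; apply: le_lt_trans gl _.
  by rewrite lte_fin; lra.
have [z maxz] : exists z, dist_maximum d Y z.
  apply: hmax => F fF FY; apply: eq0_le_eps => [|eps e0].
    by apply: le_ereal_inf_tmp => _ [y _ <-]; apply: sup_nneg_ge0.
  have e2 : (0 < eps / 2)%R by lra.
  have e20 : 0 < (eps / 2)%:E by rewrite lte_fin.
  have FYl y : F y -> l y < (eps / 2)%:E by move=> /FY ->.
  (* A late [x g] is within [eps / 2] of all of [F], where the upper limits vanish, and some [y] of
     [Y] is within [eps / 2] of [x g]. *)
  have [g [hF [y Yy gy]]] := filter_ex (filterI
    (filter_finite fF (fun y Fy => near_upper_limit_lt (FYl y Fy))) (nearY _ e2)).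
  apply: (@le_trans _ _ (sup_nneg [set d a y | a in F])).
    by apply: ereal_inf_lbound; exists y.
  apply: sup_nneg_le => [|_ [a Fa <-]]; first by rewrite lee_fin ltW.
  apply: le_trans (dist_under_triangle hd (x g) _ _) _.
  by apply/ltW/lte_half_add => //; apply: hF.
exists z => c; apply/eqP; rewrite eq_le; apply/andP; split.
  apply: (maximum_le_upper_limit hd hL maxz); apply: near_under_le => // eps e0.
  by apply: filterS (nearY _ e0) => g [y Yy /ltW]; exists y.
by rewrite -[d c z]adde0; apply: (maximum_ge_upper_limit hd hL maxz) => y; rewrite /Y /= /l => ->.
Qed.

(** * Condition (4): exact chains from approximate ones *)

Hypothesis Phi_d : precapprox (comp_Phi e d) d.

(** [Phi_d] provides one modulus valid for all functions [d^~ y], so [del] depends on [eps]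
    alone. *)
Lemma exists_near_below (eps : R) : (0 < eps)%R -> exists2 del : R, (0 < del)%R &
  forall x y, d x y < del%:E -> exists2 z, e x z <= eps%:E & d z y = 0.
Proof.
move=> e0.
have /choice [m hm] (eta : R) : exists del : R, (0 < eta)%R -> (0 < del)%R /\
    forall a b, d a b < del%:E -> forall eps : R, (0 < eps)%R ->
      exists2 z, e a z < eta%:E & d z b < eps%:E.
  have [eta0|] := pselect (0 < eta)%R; last by exists 0%R.
  have [del d0 h] := precapprox_small (dist_ge0 hd) Phi_d eta0.
  exists del => _; split=> // a b /h ab r r0.
  by apply: comp_Phi_lt r0 ab; exact: dist_ge0.
exists (m (eps / 2)%R) => [|x y xy].
  by have [] := hm (eps / 2)%R ltac:(lra).
apply: (exists_near_zero (f := d^~ y) (m := m)) xy => //.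
- by move=> a; apply: dist_ge0.
- by move=> a b; apply: dist_over_triangle.
- by move=> eta /hm[].
- by move=> eta /hm[_ h] a ay r r0; apply: h.
Qed.

(* Corrections propagate from the top of the chain downwards. *)
Lemma exists_chain_below n (eps : R) : (0 < eps)%R -> exists2 del : R, (0 < del)%R &
  forall (y : nat -> X) w, (forall k, (k < n)%N -> d (y k) (y k.+1) = 0) ->
    d (y n) w < del%:E ->
    exists z : nat -> X, [/\ forall k, (k <= n)%N -> e (y k) (z k) <= eps%:E,
      forall k, (k < n)%N -> d (z k) (z k.+1) = 0 & d (z n) w = 0].
Proof.
move=> e0; elim: n => [|n [del d0 IH]].
  have [del d0 h] := exists_near_below e0; exists del => // y w _ /h[z yz zw].
  by exists (fun=> z); split=> // k; rewrite leqn0 => /eqP->.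
(* A correction of the top point by less than [rho] spoils the zero distance to it by less than
   [del], so the induction hypothesis applies with [z] as upper point. *)
have [rho r0 hr] := precapprox_small (dist_ge0 he) under_e d0.
have m0 : (0 < Num.min eps (rho / 2))%R by rewrite lt_min e0 divr_gt0.
have [del' d'0 h] := exists_near_below m0.
exists del' => // y w hy /h[z yz zw].
have [yz1 yz2] : e (y n.+1) z <= eps%:E /\ e (y n.+1) z < rho%:E.
  move: yz; rewrite EFin_min le_min => /andP[-> /le_lt_trans lt]; split=> //.
  by apply: lt; rewrite lte_fin; lra.
have [||u [u1 u2 u3]] := IH y z.
- by move=> k kn; apply: hy; apply: ltnW.
- apply: le_lt_trans (dist_under_triangle hd (y n.+1) _ _) _.
  by rewrite hy// add0e hr.
exists (fun k => if (k <= n)%N then u k else z); split=> [k|k|].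
- rewrite leq_eqVlt => /orP[/eqP->|]; first by rewrite ltnn.
  by rewrite ltnS => kn; rewrite kn; apply: u1.
- rewrite ltnS {1}leq_eqVlt => /orP[/eqP->|kn]; first by rewrite leqnn ltnn.
  by rewrite (ltnW kn) kn; apply: u2.
- by rewrite ltnn.
Qed.

(* Stage n is an increasing chain of length n ending at x n; the k-th entries of
   the successive stages form an e-Cauchy sequence with limit y k. *)
Lemma exists_chain_moduli : exists2 del : nat -> R, (forall n, 0 < del n)%R &
  forall x : nat -> X, (forall n, d (x n) (x n.+1) < (del n)%:E) ->
  exists y : nat -> X, (forall n, d (y n) (y n.+1) = 0) /\
    (forall n, e (x n) (y n) <= (1 / 2 ^+ n)%:E).
Proof.
have p0 n : (0 < 1 / 2 ^+ n :> R)%R by rewrite divr_gt0// exprn_gt0.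
have /choice [del hdel] n : exists del : R, (0 < del)%R /\
    forall (y : nat -> X) w, (forall k, (k < n)%N -> d (y k) (y k.+1) = 0) ->
    d (y n) w < del%:E ->
    exists z : nat -> X, [/\ forall k, (k <= n)%N -> e (y k) (z k) <= (1 / 2 ^+ n.+1)%:E,
      forall k, (k < n)%N -> d (z k) (z k.+1) = 0 & d (z n) w = 0].
  by have [del d0 h] := exists_chain_below n (p0 n.+1); exists del.
exists del => [n|x hx]; first by have [] := hdel n.
have step (p : nat * (nat -> X)) : exists z : nat -> X,
    (forall k, (k < p.1)%N -> d (p.2 k) (p.2 k.+1) = 0) -> p.2 p.1 = x p.1 ->
    [/\ forall k, (k <= p.1)%N -> e (p.2 k) (z k) <= (1 / 2 ^+ p.1.+1)%:E,
        forall k, (k < p.1.+1)%N -> d (z k) (z k.+1) = 0 & z p.1.+1 = x p.1.+1].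
  case: p => n y /=.
  have [[hy yn]|h] := pselect ((forall k, (k < n)%N -> d (y k) (y k.+1) = 0) /\ y n = x n);
    last by exists y => h1 h2; exfalso; apply: h.
  (* Stage [n] is corrected so that it ends exactly below [x n.+1], which is then appended. *)
  have [|u [u1 u2 u3]] := (hdel n).2 y (x n.+1) hy; first by rewrite yn.
  exists (fun k => if (k <= n)%N then u k else x n.+1) => _ _; split=> [k kn|k|].
  - by rewrite kn; apply: u1.
  - rewrite ltnS {1}leq_eqVlt => /orP[/eqP->|kn]; first by rewrite leqnn ltnn.
    by rewrite (ltnW kn) kn; apply: u2.
  - by rewrite ltnn.
have [F hF] := choice step.
pose fix Y n : nat -> X := if n is k.+1 then F (k, Y k) else fun=> x 0%N.
have hY n : (forall k, (k < n)%N -> d (Y n k) (Y n k.+1) = 0) /\ Y n n = x n.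
  by elim: n => [|n [h1 h2]] //; have [] := hF (n, Y n) h1 h2.
have heY n k : (k <= n)%N -> e (Y n k) (Y n.+1 k) <= (1 / 2 ^+ n.+1)%:E.
  by move=> kn; have [h1 h2] := hY n; have [h _ _] := hF (n, Y n) h1 h2; apply: h.
(* The case [n = k] is the closeness of [x k] to [y k], as [Y k k = x k]. *)
have /choice [y hy] k : exists y, forall n, (k <= n)%N -> e (Y n k) y <= (1 / 2 ^+ n)%:E.
  have [|y hy] := geometric_chain_limit (y := fun m => Y (k + m)%N k) he ce (p0 k).
    move=> m; rewrite addnS; apply: le_trans (heY _ _ (leq_addr _ _)) _.
    by rewrite lee_fin -addnS exprD invfM mulrA.
  exists y => n kn; have := hy (n - k)%N; rewrite subnKC// => /le_trans; apply.
  by rewrite lee_fin -{2}(subnKC kn) exprD invfM mulrA.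
exists y; split=> [k|n]; last by rewrite -(hY n).2; apply: hy.
apply: eq0_le_eps => [|eps e0]; first exact: dist_ge0.
have e2 : (0 < eps / 2)%R by lra.
have ek i j : e (Y (i + j)%N i) (y i) <= ((1 / 2 ^+ i) / 2 ^+ j)%:E.
  by apply: le_trans (hy i _ (leq_addr _ _)) _; rewrite lee_fin exprD invfM mulrA.
have [N1 hN1] := eventually_under_small (p0 k) e2 (ek k).
have [N2 hN2] := eventually_under_small (p0 k.+1) e2 (ek k.+1).
(* [y k] and [y k.+1] are compared through a single stage [k + j.+1 = k.+1 + j], whose entries [k]
   and [k.+1] are at distance 0. *)
pose j := maxn N1 N2.
have [_ h1] := hN1 j.+1 (leqW (leq_maxl _ _)).
have [h2 _] := hN2 j (leq_maxr _ _).
apply: le_trans (dist_over_triangle hd (Y (k + j.+1)%N k) _ _) _.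
apply/ltW/lte_half_add => //.
apply: le_lt_trans (dist_under_triangle hd (Y (k + j.+1)%N k.+1) _ _) _.
have [-> //] := hY (k + j.+1)%N; last by rewrite addnS ltnS leq_addr.
by rewrite add0e addnS -addSn.
Qed.

(** The exact steps make the range of [y] order-directed. Each [y k] has upper limit 0, since it is
    below a late [y n], which is [dist_over]-close to [x n]. *)
Lemma upper_limit_attained_seq (x y : nat -> X) :
  net_cauchy d (fun m n => m < n)%N x ->
  (forall n, d (y n) (y n.+1) = 0) ->
  (forall n, e (x n) (y n) <= (1 / 2 ^+ n)%:E) ->
  (forall Y : set X, rel_directed (le_rel d) Y -> exists z, dist_maximum d Y z) ->
  exists z, forall c, d c z = upper_limit d (fun m n => m < n)%N x c.
Proof.
move=> hx y0 xy hmax; have hN := net_index_ltn; have FF := net_tails_proper hN.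
have ymn m k : d (y m) (y (m + k.+1)%N) = 0.
  elim: k => [|k IH]; first by rewrite addn1.
  apply/eqP; rewrite eq_le (dist_ge0 hd) andbT.
  apply: le_trans (dist_triangle hd (y (m + k.+1)%N) _ _) _.
  by rewrite IH add0e (addnS m k.+1) y0.
have ylt m n : (m < n)%N -> d (y m) (y n) = 0.
  by move=> mn; rewrite -(subnKC mn) addSnnS ymn.
have [z maxz] : exists z, dist_maximum d (range y) z.
  apply: hmax => F fF FY.
  have : \forall n \near net_tails (fun m n : nat => (m < n)%N),
      forall a, F a -> d a (y n) = 0.
    by apply: filter_finite fF _ => a /FY[m _ <-]; exists m => n; apply: ylt.
  by move=> /filter_ex[n hn]; exists (y n) => //; exists n.
exists z => c; apply/eqP; rewrite eq_le; apply/andP; split.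
  apply: (maximum_le_upper_limit hd hN maxz); apply: near_under_le => // eps e0.
  have [N h] := eventually_under_small ltr01 e0 xy.
  exists N => n /ltnW Nn; exists (y n); first by exists n.
  by have [/ltW] := h _ Nn.
rewrite -[d c z]adde0; apply: (maximum_ge_upper_limit hd hN maxz) => _ [k _ <-].
suff -> : upper_limit d (fun m n => m < n)%N x (y k) = 0 by [].
apply: eq0_le_eps => [|eps e0]; first exact: upper_limit_ge0.
have e2 : (0 < eps / 2)%R by lra.
have [N h] := eventually_under_small ltr01 e2 xy.
have [n [nn [kn Nn]]] := filter_ex
  (filterI (near_upper_limit_small hN hx e2) (filterI (near_tail k) (near_tail N))).
apply: le_trans (upper_limit_triangle x hd hN (y k) (y n)) _.
rewrite ylt// add0e; apply: le_trans (upper_limit_over_triangle x hd hN _ (x n)) _.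
have -> : eps%:E = (eps / 2)%:E + (eps / 2)%:E by rewrite -EFinD -splitr.
by apply: leeD => //; apply/ltW; apply: (h _ (ltnW Nn)).2.
Qed.

End ApproximatingDistance.

(** * From nets to fast sequences under separability *)

Section Separable.
Context {R : realType} {X L : Type} (d : X -> X -> \bar R)
  (prec : L -> L -> Prop) (x : L -> X).
Hypotheses (hd : is_distance d) (hL : net_index prec) (hx : net_cauchy d prec x).

Lemma dense_over_near (D : set X) :
  dense (D : set (subbase_space
    (sub_upper_ball (dist_over d) `|` sub_lower_ball (dist_over d)))) ->
  forall c (eps : R), (0 < eps)%R -> exists2 q, D q &
    dist_over d c q < eps%:E /\ dist_over d q c < eps%:E.
Proof.
move=> dD c eps e0.
pose S := sub_upper_ball (dist_over d) `|` sub_lower_ball (dist_over d).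
pose U : set (subbase_space S) := [set q | dist_over d c q < eps%:E].
pose V : set (subbase_space S) := [set q | dist_over d q c < eps%:E].
have oU : open U by apply: open_subbase; left; exists c, eps.
have oV : open V by apply: open_subbase; right; exists c, eps.
have cc : dist_over d c c < eps%:E.
  apply: (@le_lt_trans _ _ 0); last by rewrite lte_fin.
  by apply: sup_nneg_le => // _ [y _ <-]; rewrite trunc_sub_le ?(dist_ge0 hd)// adde0.
have [q [[Uq Vq] Dq]] := dD (U `&` V) (ex_intro _ c (conj cc cc)) (openI oU oV).
by exists q.
Qed.

(** By the triangle inequality for [dist_over], controlling the upper limits on a countable dense
    set controls them everywhere. *)
Lemma exists_subsequence (del : nat -> R) :
  (forall n, 0 < del n)%R ->
  separable_for (sub_upper_ball (dist_over d) `|` sub_lower_ball (dist_over d)) ->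
  exists g : nat -> L, [/\ net_cauchy d (fun m n => m < n)%N (x \o g),
    forall n, d (x (g n)) (x (g n.+1)) < (del n)%:E &
    forall c, upper_limit d (fun m n => m < n)%N (x \o g) c = upper_limit d prec x c].
Proof.
move=> del0 [D [cD /dense_over_near dD]].
have FF := net_tails_proper hL; have FN := net_tails_proper net_index_ltn.
have [l0] : inhabited L by case: hL.
have p0 n : (0 < 1 / 2 ^+ n :> R)%R by rewrite divr_gt0// exprn_gt0.
(* [q] inverts an injection of [D] into the naturals. Outside its image the value is arbitrary, so
   [q] may leave [D] but still covers it. *)
have [q hq] : exists q : nat -> X, forall a, D a -> exists i, q i = a.
  have /countable_injP[f f_inj] := cD.
  have /choice[q hq] i : exists a, (exists2 b, D b & f b = i) -> D a /\ f a = i.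
    have [[b Db fb]|h] := pselect (exists2 b, D b & f b = i); first by exists b.
    by exists (x l0) => /h.
  exists q => a Da; exists (f a); have [|Dq fq] := hq (f a); first by exists a.
  by apply: f_inj => //; rewrite inE.
(* Halving [del n] makes the later bound strict; the other term makes the subsequence Cauchy. *)
pose mu n := (Num.min (del n / 2) (1 / 2 ^+ n))%R.
have mu0 n : (0 < mu n)%R by rewrite lt_min divr_gt0 ?p0.
(* Diagonal control: stage [n] handles only [q 0] to [q n], which are finitely many tail
   conditions. *)
pose P n g := (forall l, prec g l -> d (x g) (x l) <= (mu n)%:E) /\
  (forall i, `I_n.+1 i -> d (q i) (x g) <= upper_limit d prec x (q i) + (1 / 2 ^+ n)%:E).
have nearP n : \forall g \near net_tails prec, P n g.
  have near_q i : \forall g \near net_tails prec,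
      d (q i) (x g) <= upper_limit d prec x (q i) + (1 / 2 ^+ n)%:E.
    have [->|qy] := eqVneq (upper_limit d prec x (q i)) +oo.
      by apply: nearW => l; rewrite addye ?leey.
    have := near_upper_limit_lt (ge0_lte_addr (upper_limit_ge0 _ _ _ _) qy (p0 n)).
    by apply: filterS => l /ltW.
  apply: filterI; first exact: (net_cauchyP _ _ hL).1.
  exact: filter_finite (finite_II n.+1) (fun i _ => near_q i).
have step (p : nat * L) : exists g, prec p.2 g /\ P p.1 g.
  exact: filter_ex (filterI (near_tail p.2) (nearP p.1)).
have [F hF] := choice step.
pose fix g n := if n is k.+1 then F (n, g k) else F (0%N, l0).
have gP n : P n (g n) by case: n => [|n]; apply: (hF (_, _)).2.
have gS n : prec (g n) (g n.+1) := (hF (n.+1, g n)).1.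
have gk m k : prec (g m) (g (m + k.+1)%N).
  elim: k => [|k IH]; first by rewrite addn1.
  by rewrite (addnS m k.+1); case: hL => _ tr _; apply: tr IH (gS _).
have gmn m n : (m < n)%N -> prec (g m) (g n).
  by move=> mn; rewrite -(subnKC mn) addSnnS.
have mu_half n : (mu n)%:E <= (1 / 2 ^+ n)%:E by rewrite lee_fin ge_min lexx orbT.
exists g; split=> [|n|c].
- apply/(net_cauchyP _ _ net_index_ltn) => eps e0.
  have [N hN] := expr_half_small ltr01 e0.
  exists N => m /ltnW/hN hm n mn; apply: le_trans ((gP m).1 _ (gmn _ _ mn)) _.
  by apply: le_trans (mu_half m) _; rewrite lee_fin ltW.
- apply: le_lt_trans ((gP n).1 _ (gS n)) _; rewrite lte_fin gt_min.
  by apply/orP; left; have := del0 n; lra.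
(* Only the first inequality uses density. Its three errors [eps / 3] come from passing from [c] to
   [q i], from the precision of the stage, and from passing back to [c]. *)
apply/eqP; rewrite eq_le; apply/andP; split; apply/lee_addgt0Pr => eps e0.
  have e3 : (0 < eps / 3)%R by rewrite divr_gt0.
  have [a /hq[i <-] [cq qc]] := dD c _ e3.
  apply: le_trans (upper_limit_over_triangle _ hd net_index_ltn c (q i)) _.
  have -> : upper_limit d prec x c + eps%:E =
      (eps / 3)%:E + ((eps / 3)%:E + upper_limit d prec x c + (eps / 3)%:E).
    rewrite (addeC (eps / 3)%:E (upper_limit _ _ _ _)) -addeA -EFinD addeCA -EFinD.
    by congr (_ + EFin _); lra.
  apply: leeD; first exact: ltW.
  apply: (@le_trans _ _ (upper_limit d prec x (q i) + (eps / 3)%:E)); last first.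
    rewrite leeD2r//; apply: le_trans (upper_limit_over_triangle x hd hL _ c) _.
    by rewrite leeD2r// ltW.
  apply: upper_limit_le; first by rewrite adde_ge0 ?upper_limit_ge0// lee_fin ltW.
  have [N hN] := expr_half_small ltr01 e3.
  exists (maxn N i) => n /ltnW; rewrite geq_max => /andP[/hN Nn ni].
  by apply: le_trans ((gP n).2 i _) _; rewrite //= leeD2l// lee_fin ltW.
have [->|cy] := eqVneq (upper_limit d (fun m n => m < n)%N (x \o g) c) +oo.
  by rewrite addye ?leey.
have e2 : (0 < eps / 2)%R by rewrite divr_gt0.
have [N hN] := expr_half_small ltr01 e2.
have [n [hn /ltnW/hN Nn]] := filter_ex (filterI
  (near_upper_limit_lt (ge0_lte_addr (upper_limit_ge0 _ _ _ _) cy e2)) (near_tail N)).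
apply: le_trans (upper_limit_triangle x hd hL c (x (g n))) _.
have -> : eps%:E = (eps / 2)%:E + (eps / 2)%:E by rewrite -EFinD -splitr.
rewrite addeA; apply: leeD; first exact: ltW.
apply: upper_limit_le; first by rewrite lee_fin ltW.
exists (g n) => l gl; apply: le_trans ((gP n).1 _ gl) _.
by apply: le_trans (mu_half n) _; rewrite lee_fin ltW.
Qed.

End Separable.

(** * Combination of the four cases *)

Theorem corollary11p7 (R : realType) (X : Type) (d e : X -> X -> \bar R)
  (hd : is_distance d) (he : is_distance e)
  (h :
    (* (1) *)
    [/\ precapprox (dist_comp (dist_under d) (rel_dist (le_rel (dist_set d)))) (dist_set d)
      & forall Y : set X, rel_directed (lt_rel d) Y ->
          exists x, dist_maximum d Y x]
    \/
    (* (2) *)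
    [/\ (forall (F : finsub X) (y : X),
          dist_comp (rel_dist (le_rel (finset_dist d))) (dist_over d) F y <= finset_dist d F y),
        (forall Y : set X, rel_directed (le_rel d) Y ->
          exists x, dist_maximum d Y x)
      & net_complete (dist_sym (dist_under d)) (sub_lower_hole (dist_sym (dist_under d)))]
    \/
    (* (3) *)
    [/\ precapprox (comp_Phi e (dist_over d)) d,
        precapprox (dist_under d) e,
        precapprox (dist_op (dist_over d)) e,
        (forall Y : set X, dist_directed d Y -> exists x, dist_maximum d Y x)
      & net_complete e (sub_lower_hole e)]
    \/
    (* (4) *)
    [/\ precapprox (comp_Phi e d) d,
        precapprox (dist_under d) e /\ precapprox (dist_op (dist_over d)) e,
        (forall Y : set X, rel_directed (le_rel d) Y ->
          exists x, dist_maximum d Y x),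
        net_complete e (sub_lower_hole e)
      & separable_for
          (sub_upper_ball (dist_over d) `|` sub_lower_ball (dist_over d))]) :
  net_complete d (sub_upper_ball d `|` sub_lower_hole d).
Proof.
move=> L prec x hL hx.
suff [z hz] : exists z, forall c, d c z = upper_limit d prec x c.
  by exists z; apply: cvg_upper_limit.
case: h => [[h hmax]|[[hF hmax hc]|[[hPhi hu ho hmax hc]|[hPhi [hu ho] hmax hc hsep]]]].
- exact: upper_limit_attained_lt_rel.
- exact: upper_limit_attained_finset.
- exact: (upper_limit_attained_directed hd he hu ho hc).
(* The moduli depend on [d] and [e] only, so the subsequence can be chosen afterwards to meet
   them. *)
- have [del del0 hdel] := exists_chain_moduli hd he hu ho hc hPhi.
  have [g [gc gd gl]] := exists_subsequence hd hL hx del0 hsep.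
  have [y [y0 xy]] := hdel _ gd.
  have [z hz] := upper_limit_attained_seq hd he hu ho gc y0 xy hmax.
  by exists z => c; rewrite hz gl.
Qed.
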